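(* Suppose that $K$ is an infinite compact Hausdorff space such that $C(K)$ is a Grothendieck space of density $\omega_1$. Then $C(K)$ does not admit an overcomplete set.
   Context: $C(K)$ is the real Banach space of real-valued continuous functions on $K$ with the supremum norm. $dens(X)$ (the density) is the minimal cardinality of a norm dense subset of a Banach space $X$. A subset $Y$ of a Banach space $X$ is called overcomplete (in $X$) if $|Y|=dens(X)$ and every $Z\subseteq Y$ with $|Z|=|Y|$ is linearly dense in $X$ (its linear span is norm dense in $X$). $X$ is a Grothendieck space if weakly$^*$ convergent sequences in $X^*$ coincide with weakly convergent sequences. *)

(* Defs.v *)
From HB Require Import structures.
From mathcomp Require Import all_boot all_order all_algebra.
From mathcomp Require Import all_classical all_reals all_analysis.

Set Implicit Arguments.
Unset Strict Implicit.
Unset Printing Implicit Defensive.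

Import Order.TTheory GRing.Theory Num.Theory.
Import numFieldNormedType.Exports.

Local Open Scope classical_set_scope.
Local Open Scope card_scope.
Local Open Scope ring_scope.

Section continuous_functions.
Variables (R : realType) (K : topologicalType).

(* Compactness of [K] is carried as a parameter of the type: it is what makes
   the supremum norm finite. *)
Definition Cspace (cK : compact [set: K]) : Type := continuousType K R.

Variable cK : compact [set: K].
Local Notation C := (Cspace cK).
Implicit Types f g h : C.

HB.instance Definition _ := Choice.on C.

Let add_cont f g : continuous (fun x => f x + g x).
Proof. by move=> x; apply: cvgD; exact: cts_fun. Qed.
Let opp_cont f : continuous (fun x => - f x).
Proof. by move=> x; apply: cvgN; exact: cts_fun. Qed.
Let scale_cont (a : R) f : continuous (fun x => a * f x).
Proof. by move=> x; apply: cvgMl_tmp; exact: cts_fun. Qed.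
Let zero_cont : continuous (fun _ : K => 0 : R).
Proof. by move=> x; exact: cvg_cst. Qed.

Definition C_mk (f : K -> R) (cf : continuous f) : C :=
  HB.pack_for (continuousType K R) f (isContinuous.Build K R f cf).
Definition C_zero : C := C_mk zero_cont.
Definition C_add f g : C := C_mk (@add_cont f g).
Definition C_opp f : C := C_mk (@opp_cont f).
Definition C_scale (a : R) f : C := C_mk (@scale_cont a f).

Lemma C_ext f g : (forall x, f x = g x) -> f = g.
Proof. by move=> fg; apply/continuousEP; exact: fg. Qed.

Let addA : associative C_add.
Proof. by move=> f g h; apply: C_ext => x /=; exact: addrA. Qed.
Let addC : commutative C_add.
Proof. by move=> f g; apply: C_ext => x /=; exact: addrC. Qed.
Let add0 : left_id C_zero C_add.
Proof. by move=> f; apply: C_ext => x /=; exact: add0r. Qed.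
Let addN : left_inverse C_zero C_opp C_add.
Proof. by move=> f; apply: C_ext => x /=; exact: addNr. Qed.

HB.instance Definition _ := GRing.isZmodule.Build C addA addC add0 addN.

Let scaleA (a b : R) f : C_scale a (C_scale b f) = C_scale (a * b) f.
Proof. by apply: C_ext => x /=; exact: mulrA. Qed.
Let scale1 : left_id 1 C_scale.
Proof. by move=> f; apply: C_ext => x /=; exact: mul1r. Qed.
Let scaleDr : right_distributive C_scale +%R.
Proof. by move=> a f g; apply: C_ext => x /=; exact: mulrDr. Qed.
Let scaleDl f : {morph C_scale^~ f : a b / a + b}.
Proof. by move=> a b; apply: C_ext => x /=; exact: mulrDl. Qed.

HB.instance Definition _ :=
  GRing.Zmodule_isLmodule.Build R C scaleA scale1 scaleDr scaleDl.

Definition C_norm f : R := sup [set `|f x| | x in [set: K]].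

Lemma C_has_ubound f : has_ubound [set `|f x| | x in [set: K]].
Proof.
have := continuous_compact (continuous_subspaceT (@cts_fun _ _ f)) cK.
move=> /compact_bounded[M [_ /(_ (M + 1))]]; rewrite ltrDl ltr01 => /(_ isT) fM.
by exists (M + 1) => _ [x _ <-]; apply: fM; exists x.
Qed.

Lemma C_norm_ub f x : `|f x| <= C_norm f.
Proof. by apply: ub_le_sup; [exact: C_has_ubound|exists x]. Qed.

Lemma C_norm_le f (M : R) : 0 <= M -> (forall x, `|f x| <= M) -> C_norm f <= M.
Proof.
move=> M0 fM; rewrite /C_norm.
have [->|/set0P ne] := eqVneq [set `|f x| | x in [set: K]] set0.
  by rewrite sup0.
by apply: ge_sup => // _ [x _ <-]; exact: fM.
Qed.

Lemma C_norm_ge0 f : 0 <= C_norm f.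
Proof.
rewrite /C_norm.
have [->|/set0P[_ [x _ _]]] := eqVneq [set `|f x| | x in [set: K]] set0.
  by rewrite sup0.
exact: le_trans (normr_ge0 _) (C_norm_ub f x).
Qed.

Let C_normD f g : C_norm (f + g) <= C_norm f + C_norm g.
Proof.
apply: C_norm_le => [|x]; first by rewrite addr_ge0// C_norm_ge0.
by apply: le_trans (ler_normD _ _) _; rewrite lerD// C_norm_ub.
Qed.

Let C_normZ (a : R) f : C_norm (a *: f) = `|a| * C_norm f.
Proof.
have nle (b : R) g : C_norm (b *: g) <= `|b| * C_norm g.
  apply: C_norm_le => [|x]; first by rewrite mulr_ge0// C_norm_ge0.
  by rewrite [_ x]/= normrM ler_wpM2l// C_norm_ub.
apply/eqP; rewrite eq_le nle/=.
have [->|a0] := eqVneq a 0; first by rewrite normr0 mul0r C_norm_ge0.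
rewrite -ler_pdivlMl ?normr_gt0// -normfV.
by apply: le_trans (nle _ _); rewrite scalerA mulVf// scale1r.
Qed.

Let C_norm0_eq0 f : C_norm f = 0 -> f = 0.
Proof.
move=> f0; apply: C_ext => x; apply/eqP.
by rewrite -normr_le0 -f0 C_norm_ub.
Qed.

HB.instance Definition _ :=
  Lmodule_isNormed.Build R C C_normD C_normZ C_norm0_eq0.

End continuous_functions.

Section dual_space.
Variables (R : realType) (X : normedModType R).

Record dual : Type := Dual {
  dual_fun :> X -> R;
  dual_linear : linear dual_fun;
  dual_continuous : continuous dual_fun }.

HB.instance Definition _ (f : dual) :=
  GRing.isLinear.Build R X R _ (dual_fun f) (@dual_linear f).

Implicit Types f g h : dual.

HB.instance Definition _ := gen_eqMixin dual.
HB.instance Definition _ := gen_choiceMixin dual.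

Lemma dual_ext f g : (forall x, f x = g x) -> f = g.
Proof.
case: f g => [f lf cf] [g lg cg] /= /funext fg; move: lf cf; rewrite fg => lf cf.
by congr Dual; exact: Prop_irrelevance.
Qed.

Let add_lin f g : linear (fun x => f x + g x).
Proof. by move=> a x y; rewrite (linearP f) (linearP g) scalerDr addrACA. Qed.
Let add_cont f g : continuous (fun x => f x + g x).
Proof. by move=> x; apply: cvgD; exact: dual_continuous. Qed.
Let opp_lin f : linear (fun x => - f x).
Proof. by move=> a x y; rewrite (linearP f) opprD scalerN. Qed.
Let opp_cont f : continuous (fun x => - f x).
Proof. by move=> x; apply: cvgN; exact: dual_continuous. Qed.
Let scale_lin (b : R) f : linear (fun x => b * f x).
Proof. by move=> a x y; rewrite (linearP f) mulrDr mulrCA. Qed.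
Let scale_cont (a : R) f : continuous (fun x => a * f x).
Proof. by move=> x; apply: cvgMl_tmp; exact: dual_continuous. Qed.
Let zero_lin : linear (fun _ : X => 0 : R).
Proof. by move=> a x y; rewrite scaler0 addr0. Qed.
Let zero_cont : continuous (fun _ : X => 0 : R).
Proof. by move=> x; exact: cvg_cst. Qed.

Definition dual_zero : dual := Dual zero_lin zero_cont.
Definition dual_add f g : dual := Dual (@add_lin f g) (@add_cont f g).
Definition dual_opp f : dual := Dual (@opp_lin f) (@opp_cont f).
Definition dual_scale (a : R) f : dual := Dual (@scale_lin a f) (@scale_cont a f).

Let addA : associative dual_add.
Proof. by move=> f g h; apply: dual_ext => x /=; exact: addrA. Qed.
Let addC : commutative dual_add.
Proof. by move=> f g; apply: dual_ext => x /=; exact: addrC. Qed.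
Let add0 : left_id dual_zero dual_add.
Proof. by move=> f; apply: dual_ext => x /=; exact: add0r. Qed.
Let addN : left_inverse dual_zero dual_opp dual_add.
Proof. by move=> f; apply: dual_ext => x /=; exact: addNr. Qed.

HB.instance Definition _ := GRing.isZmodule.Build dual addA addC add0 addN.

Let scaleA (a b : R) f : dual_scale a (dual_scale b f) = dual_scale (a * b) f.
Proof. by apply: dual_ext => x /=; exact: mulrA. Qed.
Let scale1 : left_id 1 dual_scale.
Proof. by move=> f; apply: dual_ext => x /=; exact: mul1r. Qed.
Let scaleDr : right_distributive dual_scale +%R.
Proof. by move=> a f g; apply: dual_ext => x /=; exact: mulrDr. Qed.
Let scaleDl f : {morph dual_scale^~ f : a b / a + b}.
Proof. by move=> a b; apply: dual_ext => x /=; exact: mulrDl. Qed.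

HB.instance Definition _ :=
  GRing.Zmodule_isLmodule.Build R dual scaleA scale1 scaleDr scaleDl.

Definition dual_norm f : R := sup [set `|f x| | x in [set x | `|x| <= 1]].

Lemma dual_has_sup f : has_sup [set `|f x| | x in [set x | `|x| <= 1]].
Proof.
split; first by exists `|f 0|, 0 => //=; rewrite normr0.
have /linear_bounded_continuous/bounded_funP/(_ 1)[M fM] :=
  @dual_continuous f.
by exists M => _ [x x1 <-]; exact: fM.
Qed.

Lemma dual_norm_ub f x : `|x| <= 1 -> `|f x| <= dual_norm f.
Proof. by move=> x1; apply: sup_ubound; [case: (dual_has_sup f)|exists x]. Qed.

Lemma dual_norm_le f (M : R) :
  (forall x, `|x| <= 1 -> `|f x| <= M) -> dual_norm f <= M.
Proof.
move=> fM; apply: ge_sup; first by case: (dual_has_sup f).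
by move=> _ [x x1 <-]; exact: fM.
Qed.

Lemma dual_norm_ge0 f : 0 <= dual_norm f.
Proof. by apply: le_trans (normr_ge0 _) (@dual_norm_ub f 0 _); rewrite normr0. Qed.

Lemma dual_norm_op f x : `|f x| <= dual_norm f * `|x|.
Proof.
have [->|x0] := eqVneq x 0; first by rewrite linear0 !normr0 mulr0.
rewrite -ler_pdivrMr ?normr_gt0//.
have := @dual_norm_ub f (`|x|^-1 *: x); rewrite normfZV// => /(_ (lexx _)).
by rewrite linearZ/= normrM normfV normr_id mulrC.
Qed.

Let dual_normD f g : dual_norm (f + g) <= dual_norm f + dual_norm g.
Proof.
apply: dual_norm_le => x x1.
by apply: le_trans (ler_normD _ _) _; rewrite lerD// dual_norm_ub.
Qed.

Let dual_normZ (a : R) f : dual_norm (a *: f) = `|a| * dual_norm f.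
Proof.
have nle (b : R) g : dual_norm (b *: g) <= `|b| * dual_norm g.
  by apply: dual_norm_le => x x1; rewrite [_ x]/= normrM ler_wpM2l// dual_norm_ub.
apply/eqP; rewrite eq_le nle/=.
have [->|a0] := eqVneq a 0; first by rewrite normr0 mul0r dual_norm_ge0.
rewrite -ler_pdivlMl ?normr_gt0// -normfV.
by apply: le_trans (nle _ _); rewrite scalerA mulVf// scale1r.
Qed.

Let dual_norm0_eq0 f : dual_norm f = 0 -> f = 0.
Proof.
move=> f0; apply: dual_ext => x; apply/eqP.
by rewrite -normr_le0; apply: le_trans (dual_norm_op f x) _; rewrite f0 mul0r.
Qed.

HB.instance Definition _ :=
  Lmodule_isNormed.Build R dual dual_normD dual_normZ dual_norm0_eq0.

End dual_space.

Section banach_space_notions.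
Variable R : realType.
Implicit Types X : normedModType R.

Definition weak_cvg X (u : nat -> X) (l : X) : Prop :=
  forall f : dual X, f (u n) @[n --> \oo] --> f l.

Definition weak_star_cvg X (u : nat -> dual X) (l : dual X) : Prop :=
  forall x : X, u n x @[n --> \oo] --> l x.

Definition grothendieck X : Prop :=
  forall (u : nat -> dual X) (l : dual X), weak_star_cvg u l <-> weak_cvg u l.

Definition linear_span X (A : set X) : set X :=
  [set x | exists (n : nat) (c : 'I_n -> R) (v : 'I_n -> X),
    (forall i, A (v i)) /\ x = \sum_(i < n) c i *: v i].

Definition linearly_dense X (A : set X) : Prop := dense (linear_span A).

(* Cardinals are not types here; [dens_eq X A] states [dens X = |A|]. *)
Definition dens_eq X (U : Type) (A : set U) : Prop :=
  (exists2 D : set X, dense D & D #= A) /\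
  (forall D : set X, dense D -> A #<= D).

Definition overcomplete X (Y : set X) : Prop :=
  dens_eq X Y /\
  (forall Z : set X, Z `<=` Y -> Z #= Y -> linearly_dense Z).

End banach_space_notions.

(* [|A| = omega_1]: the cardinal of [A] is the least uncountable one. *)
Definition card_omega1 (U : Type) (A : set U) : Prop :=
  ~ countable A /\ (forall (V : Type) (B : set V), ~ countable B -> A #<= B).

Definition dens_omega1 (R : realType) (X : normedModType R) : Prop :=
  exists2 D : set X, card_omega1 D & dens_eq X D.

(* Main.v *)
(** Let [Y] be overcomplete in [C(K)].  As [Y] has cardinality [omega_1], a
    functional vanishing at uncountably many points of [Y] is zero.

    Every nonempty weak* compact convex set [S] of functionals that misses the
    line spanned by some [u <> 0] then has a weak* G_delta point.  By Zorn's
    lemma, impose on [s] in [S] a maximal consistent family of constraints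
    [s y = q * u y] with [y] in [Y] and [q] rational.  It is countable, since
    uncountably many constraints with the same [q] force [s = q u].  By
    maximality, at all but countably many [y] in [Y] the quotient [s y / u y]
    omits the rationals while [s] ranges over the convex set of solutions; so
    it is constant there, and any two solutions agree at uncountably many [y].

    Choose points [x m] of [K] and [0 <= h n <= 1] in [C(K)] with
    [h n (x m) = 1] for [m < n] and [0] for [m >= n], and let [Phi] in the
    bidual be an ultrafilter limit of the evaluations at [h n].  Let [T m] be
    the convex set of [mu] in the dual ball with [mu 1 = 1], [mu (h n) = 0] for
    [n <= m] and [Phi mu = 1]; it contains the point masses at [x k], [k >= m].
    A G_delta point [s] of the intersection of the weak* closures of the [T m]
    is a weak* limit of some [g m] in [T m].  But [Phi (g m) = 1], whereas
    [s (h n) = 0] for all [n] gives [Phi s = 0], so [g] does not converge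
    weakly. *)
From HB Require Import structures.
Require Import Defs.
From mathcomp Require Import all_boot all_order all_algebra.
From mathcomp Require Import all_classical all_reals all_analysis.
From mathcomp Require Import ring.

Set Implicit Arguments.
Unset Strict Implicit.
Unset Printing Implicit Defensive.

Import Order.TTheory GRing.Theory Num.Theory.
Import numFieldNormedType.Exports.

Local Open Scope classical_set_scope.
Local Open Scope ring_scope.

(** * Ultrafilter limits and weak* compactness of the dual ball *)

Lemma ultra_cvg_bounded (R : realType) (I : Type) (U : set_system I)
    (h : I -> R) (M : R) : UltraFilter U -> (forall i, `|h i| <= M) ->
  exists l : R, h i @[i --> U] --> l.
Proof.
move=> UU hM.
have UP : ProperFilter U by exact: ultra_proper.
have UF : Filter U by exact: filter_filter.
have hFP : ProperFilter (h i @[i --> U]) by exact: fmap_proper_filter.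
have FI : (h i @[i --> U]) [set` `[- M, M]].
  by rewrite /fmap /=; apply: filterE => i /=; rewrite in_itv /= -ler_norml;
  exact: hM.
have [l [_ hl]] := @segment_compact R (- M) M _ hFP FI.
exists l => B Bl.
have [//|UnB] := in_ultra_setVsetC (h @^-1` B) UU.
by have [x []] : (~` B) `&` B !=set0 by exact: hl.
Qed.

Lemma contraction_continuous (R : realType) (X : normedModType R) (g : X -> R) :
  linear g -> (forall x, `|g x| <= `|x|) -> continuous g.
Proof.
move=> glin gle.
pose gl : {linear X -> R} := HB.pack g (GRing.isLinear.Build R X R _ g glin).
apply: (@bounded_linear_continuous _ _ _ gl); apply/linear_boundedP.
near=> r => x; apply: le_trans (gle x) _; rewrite ler_peMl//.
Unshelve. all: by end_near.
Qed.

(** Banach-Alaoglu in ultrafilter form: at each [x] the values are bounded, so they converge along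
    [U], and linearity and the bound pass to the limit. *)
Lemma ultra_cvg_dual (R : realType) (X : normedModType R) (I : Type)
    (U : set_system I) (phi : I -> dual X) :
  UltraFilter U -> (forall i x, `|phi i x| <= `|x|) ->
  exists psi : dual X, (forall x, `|psi x| <= `|x|) /\
    forall x, phi i x @[i --> U] --> psi x.
Proof.
move=> UU phi1.
have UP : ProperFilter U by exact: ultra_proper.
have UF : Filter U by exact: filter_filter.
have /choice[g gP] : forall x, exists l : R, phi i x @[i --> U] --> l.
  by move=> x; apply: (@ultra_cvg_bounded _ _ _ _ `|x|).
have gle x : `|g x| <= `|x|.
  have gx : `|phi i x| @[i --> U] --> `|g x| by apply: cvg_norm.
  rewrite -(cvg_lim _ gx)//; apply: limr_le.
    by apply/cvg_ex; exists `|g x|.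
  by apply: filterE => i; exact: phi1.
have glin : linear g.
  move=> a x y; apply: (cvg_unique _ (gP _)) => //.
  rewrite (_ : (fun i => phi i (a *: x + y)) =
               (fun i => a * phi i x + phi i y)).
    by apply: cvgD => //; apply: cvgMl_tmp.
  by apply/funext => i; rewrite linearP.
by exists (Dual glin (contraction_continuous glin gle)).
Qed.

(** * Weak* closures, with basic neighbourhoods given by finite lists of points *)

Definition weak_star_closure (R : realType) (X : normedModType R)
    (T : set (dual X)) : set (dual X) :=
  [set s | forall (l : seq X) (e : R), 0 < e ->
    exists2 mu, T mu & forall x, x \in l -> `|s x - mu x| < e].

Lemma near_weak_star_cvg (R : realType) (X : normedModType R) (I : Type)
    (U : set_system I) (phi : I -> dual X) (psi : dual X) (l : seq X) (e : R) :
  Filter U -> (forall x, phi i x @[i --> U] --> psi x) -> 0 < e ->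
  \forall i \near U, forall x, x \in l -> `|psi x - phi i x| < e.
Proof.
move=> UF phipsi e0; elim: l => [|x l IH]; first exact: filterE.
have := phipsi x; move/cvgrPdist_lt => /(_ e e0) Hx.
near=> i => y; rewrite inE => /orP[/eqP ->|yl]; first by near: i.
move: y yl; near: i; exact: IH.
Unshelve. all: by end_near.
Qed.

Lemma weak_star_closure_ultra (R : realType) (X : normedModType R) (I : Type)
    (U : set_system I) (phi : I -> dual X) (psi : dual X) (T : set (dual X)) :
  ProperFilter U -> (forall x, phi i x @[i --> U] --> psi x) ->
  (\forall i \near U, weak_star_closure T (phi i)) -> weak_star_closure T psi.
Proof.
move=> UP phipsi UT l e e0.
have e20 : 0 < e / 2 by rewrite divr_gt0.
have UF : Filter U by exact: filter_filter.
have H := near_weak_star_cvg l UF phipsi e20.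
have [i [Hi /(_ l _ e20)[mu Tmu mul]]] := filter_ex (filterI H UT).
exists mu => // x xl; rewrite -(subrKA (phi i x)) (splitr e).
by apply: le_lt_trans (ler_normD _ _) _; rewrite ltrD ?Hi ?mul.
Qed.

Lemma sub_weak_star_closure (R : realType) (X : normedModType R)
    (T : set (dual X)) : T `<=` weak_star_closure T.
Proof. by move=> s Ts l e e0; exists s => // x _; rewrite subrr normr0. Qed.

Definition dual_convex (R : realType) (X : normedModType R)
    (S : set (dual X)) : Prop :=
  forall (mu nu : dual X) (t : R), 0 <= t <= 1 -> S mu -> S nu ->
    S (t *: mu + (1 - t) *: nu).

Lemma convex_comb_dualE (R : realType) (X : normedModType R)
    (mu nu : dual X) (t : R) (x : X) :
  (t *: mu + (1 - t) *: nu) x = t * mu x + (1 - t) * nu x.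
Proof. by []. Qed.

Lemma weak_star_closure_convex (R : realType) (X : normedModType R)
    (T : set (dual X)) : dual_convex T -> dual_convex (weak_star_closure T).
Proof.
move=> cT mu nu t t01 cmu cnu l e e0.
have [mu' Tmu' mul] := cmu l e e0.
have [nu' Tnu' nul] := cnu l e e0.
exists (t *: mu' + (1 - t) *: nu'); first exact: cT.
move=> x xl; rewrite !convex_comb_dualE.
move: t01 => /andP[t0 t1]; have t1' : 0 <= 1 - t by rewrite subr_ge0.
have := mul x xl; have := nul x xl.
set b := nu x - nu' x; set a := mu x - mu' x => be ae.
rewrite (_ : _ - _ = t * a + (1 - t) * b); last by rewrite /a /b; ring.
apply: le_lt_trans (ler_normD _ _) _.
rewrite !normrM (ger0_norm t0) (ger0_norm t1').
have : Num.max `|a| `|b| < e by rewrite gt_max ae be.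
have : `|a| <= Num.max `|a| `|b| by rewrite le_max lexx.
have : `|b| <= Num.max `|a| `|b| by rewrite le_max lexx orbT.
move: (Num.max _ _) => m bm am; apply: le_lt_trans.
have -> : m = t * m + (1 - t) * m by ring.
by apply: lerD; exact: ler_wpM2l.
Qed.

(** * Weak* G_delta points as limits of sequences *)

Lemma countable_enum (X : Type) (x0 : X) (A : set X) : countable A ->
  exists e : nat -> X, A `<=` range e.
Proof.
move=> /pfcard_geP[->|[f]]; first by exists (fun=> x0).
by exists f => a /(@surj _ _ _ _ f)[n _ <-]; exists n.
Qed.

(** Choose [g k] in [T k] close to [s] at the first [k] points of [A]. Every ultrafilter limit of
    [g] beyond all finite indices lies in all the closures and agrees with [s] on [A], hence equals
    [s]; compactness turns this into convergence. *)
Lemma weak_star_cvg_isolated (R : realType) (X : normedModType R)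
    (T : nat -> set (dual X)) (A : set X) (s : dual X) :
  (forall m n, (m <= n)%N -> T n `<=` T m) ->
  (forall m mu x, T m mu -> `|mu x| <= `|x|) ->
  countable A -> (forall m, weak_star_closure (T m) s) ->
  (forall s', (forall m, weak_star_closure (T m) s') ->
     (forall a, A a -> s' a = s a) -> s' = s) ->
  exists2 g : nat -> dual X, (forall k, T k (g k)) & weak_star_cvg g s.
Proof.
move=> Tdec Tball /(countable_enum (0 : X))[a aA] sT sU.
have e0 (k : nat) : 0 < k.+1%:R^-1 :> R by rewrite invr_gt0.
have /choice[g gP] : forall k, exists mu, T k mu /\
    forall i, (i < k)%N -> `|s (a i) - mu (a i)| < k.+1%:R^-1.
  move=> k; have [mu Tmu mul] := sT k [seq a i | i <- iota 0 k] _ (e0 k).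
  exists mu; split=> // i ik; apply: mul; apply: map_f.
  by rewrite mem_iota add0n ik.
exists g => [k|x]; first by case: (gP k).
have ga i : g k (a i) @[k --> \oo] --> s (a i).
  apply/cvgrPdist_lt => e ep.
  have := near_infty_natSinv_lt (PosNum ep); rewrite /= => H.
  near=> k; apply: (@lt_trans _ _ k.+1%:R^-1).
    by have [_ ->//] := gP k; near: k; exists i.+1.
  by near: k.
apply/cvgrPdist_lt => e ep; apply: contrapT => nH.
(* If convergence fails at [x], the bad indices [D] meet every tail, so some ultrafilter contains
   [D] and all tails. The limit along it is [s], against the definition of [D]. *)
pose D := [set k : nat | ~ `|s x - g k x| < e].
have VP : ProperFilter (within D \oo).
  apply: Build_ProperFilter_ex => B wB; apply: contrapT => nB; apply: nH.
  have wB' : \forall k \near \oo, D k -> B k by exact: wB.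
  apply: (filterS _ wB') => k wBk; apply: contrapT => Dk; apply: nB.
  by exists k; exact: wBk.
have [U [UU VU]] := ultraFilterLemma VP.
have UP : ProperFilter U by exact: ultra_proper.
have ooU : \oo `<=` U.
  by move=> B B0; apply: VU; apply: (filterS _ B0) => k Bk _.
have [psi [psi1 gpsi]] := @ultra_cvg_dual _ _ _ U g UU
  (fun k x => Tball k (g k) x (gP k).1).
have E : psi = s.
  apply: sU => [m|_ /aA[i _ <-]].
    apply: (weak_star_closure_ultra _ gpsi); apply: ooU; exists m => // k mk.
    apply: sub_weak_star_closure; apply: Tdec mk _ _; exact: (gP k).1.
  apply: (cvg_unique _ (gpsi _)) => //.
  by apply: cvg_trans (ga i); exact: cvg_app.
have UD : U D by apply: VU; exact: withinT.
move: (gpsi x); rewrite E => /cvgrPdist_lt/(_ e ep) UH.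
by have [k [Hk Dk]] := filter_ex (filterI UH UD).
Unshelve. all: by end_near.
Qed.

(** * Existence of weak* G_delta points *)

Definition weak_star_closed (R : realType) (X : normedModType R)
    (S : set (dual X)) : Prop :=
  forall (I : Type) (U : set_system I) (phi : I -> dual X) (psi : dual X),
    ProperFilter U -> (forall i, S (phi i)) ->
    (forall x, phi i x @[i --> U] --> psi x) -> S psi.

Section isolated_point.
Variables (R : realType) (X : normedModType R) (Y : set X).
Variables (S : set (dual X)) (u : dual X).
Hypothesis S_closed : weak_star_closed S.
Hypothesis S_ball : forall s x, S s -> `|s x| <= `|x|.

Let good (B : set (X * rat)) : Prop :=
  (forall p, B p -> Y p.1) /\
  exists2 s, S s & forall p, B p -> s p.1 = ratr p.2 * u p.1.

(** Compactness: pick a solution in [S] for each member of the chain and take its limit along an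
    ultrafilter containing all tails. Each constraint holds on a tail, hence in the limit. *)
Let good_chain (F : set (set (X * rat))) :
  S !=set0 -> F `<=` good -> total_on F subset -> good (\bigcup_(B in F) B).
Proof.
move=> [s0 Ss0] Fgood Ftot; split=> [p [B FB Bp]|].
  by have [BY _] := Fgood B FB; exact: BY.
have [->|/set0P[B0 FB0]] := eqVneq F set0.
  by exists s0 => // p; rewrite bigcup_set0.
pose tail B := [set C | F C /\ B `<=` C].
have GP : ProperFilter (filter_from F tail).
  apply: filter_from_proper; last by move=> B FB; exists B; split.
  apply: filter_from_filter; first by exists B0.
  move=> B C FB FC; have [BC|CB] := Ftot _ _ FB FC.
    by exists C => // D [FD CD]; split; split=> //; apply: subset_trans CD.
  by exists B => // D [FD BD]; split; split=> //; apply: subset_trans BD.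
have [U [UU GU]] := ultraFilterLemma GP.
have UP : ProperFilter U by exact: ultra_proper.
have /choice[phi phiP] : forall B, exists s, S s /\
    (F B -> forall p, B p -> s p.1 = ratr p.2 * u p.1).
  move=> B; have [FB|nFB] := pselect (F B); last by exists s0.
  by have [_ [s Ss sB]] := Fgood B FB; exists s.
have [psi [_ psiP]] := @ultra_cvg_dual _ _ _ U phi UU
  (fun B x => S_ball x (phiP B).1).
exists psi => [|p [B FB Bp]].
  by apply: S_closed psiP => B; exact: (phiP B).1.
apply: (cvg_unique _ (psiP _)) => //; apply: cvg_near_cst.
apply: GU; exists B => // C [FC BC]; exact: (phiP C).2 FC _ (BC _ Bp).
Qed.

Hypothesis Y_test : forall f : dual X,
  ~ countable (Y `&` [set y | f y = 0]) -> f = 0.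

Lemma exists_isolated_point : ~ countable Y -> u <> 0 -> dual_convex S ->
  S !=set0 -> (forall s (q : R), S s -> s <> q *: u) ->
  exists (A : set X) (s : dual X), [/\ countable A, S s &
    forall s', S s' -> (forall a, A a -> s' a = s a) -> s' = s].
Proof.
move=> Yunc u0 Sconv Sne Su.
have [B [[BY [s Ss sB]] Bmax]] := @Zorn_bigcup _ good (fun F => good_chain Sne).
(* Sort the constrained points by their rational [q]: uncountably many with the same [q] would give
   [s = q u], which is excluded. *)
have Dcount : countable (fst @` B).
  apply: (@sub_countable _ _ _ (\bigcup_(q in [set: rat]) (Y `&`
      [set y | (s - ratr q *: u) y = 0]))).
    apply: subset_card_le => _ [[y q] Byq <-]; exists q => //.
    split; first exact: (BY _ Byq).
    rewrite /= -[LHS]/(s y - ratr q * u y); by rewrite (sB _ Byq) subrr.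
  apply: bigcup_countable => // q _; apply: contrapT => /Y_test/eqP.
  by rewrite subr_eq0 => /eqP; exact: Su.
(* The unconstrained points where the quotient by [u] makes sense; only countably many points of [Y]
   are left out. *)
pose Z := (Y `\` (fst @` B)) `&` [set y | u y <> 0].
have Zunc : ~ countable Z.
  move=> Zc; apply: Yunc.
  have uc : countable (Y `&` [set y | u y = 0]).
    by apply: contrapT => /Y_test.
  apply: (@sub_countable _ _ _ (\bigcup_(i in [set: 'I_3])
     (if i == 0%R then fst @` B
      else if i == 1%R then Y `&` [set y | u y = 0] else Z))).
    apply: subset_card_le => y Yy.
    have [By|nBy] := pselect ((fst @` B) y); first by exists 0.
    have [uy|uy] := eqVneq (u y) 0; first by exists 1.
    by exists (inord 2) => //; rewrite -!val_eqE /= inordK//=;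
      split=> //; exact/eqP.
  apply: bigcup_countable => // i _; case: ifP => // _; by case: ifP.
exists (fst @` B), s; split=> // s' Ss' s's.
have s'B p : B p -> s' p.1 = ratr p.2 * u p.1.
  by move=> Bp; rewrite -(sB p Bp); apply: s's; exists p.
(* A rational strictly between two quotients at [y] is attained by a convex combination of the two
   solutions, so a constraint at [y] could be added to the maximal [B]. *)
have sub0 (r r' : dual X) y : S r -> S r' -> 
   (forall p, B p -> r p.1 = ratr p.2 * u p.1) ->
   (forall p, B p -> r' p.1 = ratr p.2 * u p.1) ->
   Z y -> ~ r y / u y < r' y / u y.
  move=> Sr Sr' rB r'B [[Yy nBy] uy] lt_rr'.
  have [q] := rat_in_itvoo lt_rr'; rewrite in_itv /= => /andP[q1 q2].
  apply: (Bmax (B `|` [set (y, q)])).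
    split; first by move=> p Bp; left.
    by move=> /(_ (y, q) (or_intror erefl)) Byq; apply: nBy; exists (y, q).
  split; first by move=> p [/BY//|->].
  have d0 : 0 < r' y / u y - r y / u y by rewrite subr_gt0.
  (* The weight for which the quotient of [t *: r + (1 - t) *: r'] at [y] is exactly [q]. *)
  pose t := (r' y / u y - ratr q) / (r' y / u y - r y / u y).
  exists (t *: r + (1 - t) *: r').
    apply: Sconv => //; rewrite /t ler_pdivlMr// ler_pdivrMr// mul0r mul1r.
    by rewrite subr_ge0 (ltW q2) lerB//= ltW.
  move=> p [Bp|->]; rewrite convex_comb_dualE/=.
    by rewrite rB// r'B//; ring.
  have uy0 : u y != 0 by apply/eqP.
  have : (r' y / u y - r y / u y) * t = r' y / u y - ratr q.
    by rewrite mulrC /t mulfVK// gt_eqF.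
  move: (ratr q) => c tE.
  have -> : t * r y + (1 - t) * r' y =
      u y * (r' y / u y - (r' y / u y - r y / u y) * t).
    by field.
  by rewrite tE; ring.
apply/eqP; rewrite -subr_eq0; apply/eqP; apply: Y_test => c; apply: Zunc.
apply: sub_countable c; apply: subset_card_le => y Zy.
split; first by case: Zy => -[].
rewrite /= -[LHS]/(s' y - s y); apply/eqP; rewrite subr_eq0.
have uy0 : u y != 0 by case: Zy => _ /eqP.
have := sub0 s s' y Ss Ss' sB s'B Zy; have := sub0 s' s y Ss' Ss s'B sB Zy.
move=> /negP; rewrite -leNgt => le1 /negP; rewrite -leNgt => le2.
have /eqP : s' y / u y = s y / u y by apply/eqP; rewrite eq_le le1 le2.
by rewrite (inj_eq (mulIf _))// invr_eq0.
Qed.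

End isolated_point.

(** * Failure of the Grothendieck property *)

Lemma weak_star_closure_eq (R : realType) (X : normedModType R)
    (T : set (dual X)) (s : dual X) (x : X) (c : R) :
  (forall mu, T mu -> mu x = c) -> weak_star_closure T s -> s x = c.
Proof.
move=> Tc sT; apply/eqP; rewrite -subr_eq0 -normr_le0.
apply/ler_addgt0Pr => e e0.
have [mu /Tc muc /(_ x)] := sT [:: x] e e0.
by rewrite inE eqxx muc add0r => /(_ isT)/ltW.
Qed.

Lemma weak_star_closure_contraction (R : realType) (X : normedModType R)
    (T : set (dual X)) (s : dual X) :
  (forall mu x, T mu -> `|mu x| <= `|x|) -> weak_star_closure T s ->
  forall x, `|s x| <= `|x|.
Proof.
move=> Tb sT x; apply/ler_addgt0Pr => e e0.
have [mu /(Tb _ x) mub /(_ x)] := sT [:: x] e e0.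
rewrite inE eqxx => /(_ isT)/ltW smu.
by rewrite -(subrK (mu x) (s x)) addrC (le_trans (ler_normD _ _))// lerD.
Qed.

(** Places the evaluations in the unit ball of the bidual, so that [ultra_cvg_dual] applied to
    [dual X] yields [Phi]. *)
Lemma bidual_eval (R : realType) (X : normedModType R) (x : X) : `|x| <= 1 ->
  exists ev : dual (dual X),
    (forall mu, ev mu = mu x) /\ forall mu, `|ev mu| <= `|mu|.
Proof.
move=> x1; pose g (mu : dual X) : R := mu x.
have glin : linear g by [].
have gle mu : `|g mu| <= `|mu| by exact: dual_norm_ub.
by exists (Dual glin (contraction_continuous glin gle)).
Qed.

(** In the application [h] are the interpolating functions, [d] the point masses and [e] the
    constant function one. *)
Lemma not_grothendieck (R : realType) (X : normedModType R) (Y : set X)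
    (h : nat -> X) (d : nat -> dual X) (e : X) :
  ~ countable Y ->
  (forall f : dual X, ~ countable (Y `&` [set y | f y = 0]) -> f = 0) ->
  (forall n, `|h n| <= 1) -> (forall m x, `|d m x| <= `|x|) ->
  (forall m n, d m (h n) = (m < n)%:R) -> (forall m, d m e = 1) ->
  ~ grothendieck X.
Proof.
move=> Yunc Ytest h1 d1 dh de gX.
have [U [UU ooU]] := ultraFilterLemma (@eventually_filter).
have UP : ProperFilter U by exact: ultra_proper.
have /choice[ev evP] := fun n => bidual_eval (h1 n).
have [Phi [_ PhiP]] := ultra_cvg_dual UU (fun n => (evP n).2).
pose T m := [set mu : dual X | [/\ forall x, `|mu x| <= `|x|, mu e = 1,
  forall n, (n <= m)%N -> mu (h n) = 0 & Phi mu = 1]].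
pose S := [set s : dual X | forall m, weak_star_closure (T m) s].
have Tdec m n : (m <= n)%N -> T n `<=` T m.
  move=> mn mu [b mue muh mu1]; split=> // k km.
  by apply: muh; exact: leq_trans mn.
have Tconv m : dual_convex (T m).
  move=> mu nu t t01 [mub mue muh mu1] [nub nue nuh nu1]; split.
  - move=> x; rewrite convex_comb_dualE; move: t01 => /andP[t0 t1].
    have t1' : 0 <= 1 - t by rewrite subr_ge0.
    apply: le_trans (ler_normD _ _) _.
    rewrite !normrM (ger0_norm t0) (ger0_norm t1').
    have -> : `|x| = t * `|x| + (1 - t) * `|x| by ring.
    by apply: lerD; exact: ler_wpM2l.
  - by rewrite convex_comb_dualE mue nue; ring.
  - by move=> n nm; rewrite convex_comb_dualE muh// nuh//; ring.
  - by rewrite linearD !linearZ/= mu1 nu1 /GRing.scale/=; ring.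
(* [Phi (d m) = 1] because [d m (h n) = 1] as soon as [n > m]. *)
have dT m : T m (d m).
  split=> // [n nm|]; first by rewrite dh ltnNge nm.
  apply: (cvg_unique _ (PhiP _)) => //; apply: cvg_near_cst; apply: ooU.
  by exists m.+1 => // n /= mn; rewrite (evP n).1 dh mn.
have Sclosed : weak_star_closed S.
  move=> I V phi psi VP Sphi phipsi m.
  apply: weak_star_closure_ultra phipsi _; apply: filterE => i; exact: Sphi.
have Sball s x : S s -> `|s x| <= `|x|.
  move=> Ss; apply: (weak_star_closure_contraction _ (Ss 0)).
  by move=> mu y [].
have Sconv : dual_convex S.
  move=> mu nu t t01 Smu Snu m; exact: weak_star_closure_convex.
have Sne : S !=set0.
  have [psi [_ dpsi]] := ultra_cvg_dual UU d1.
  exists psi => m; apply: weak_star_closure_ultra dpsi _.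
  apply: ooU; exists m => // n mn; apply: sub_weak_star_closure.
  exact: Tdec mn _ (dT n).
have Se s : S s -> s e = 1.
  by move=> Ss; apply: (weak_star_closure_eq _ (Ss 0)) => mu [].
have Sh s n : S s -> s (h n) = 0.
  move=> Ss; apply: (weak_star_closure_eq _ (Ss n)) => mu [_ _ muh _].
  exact: muh.
(* This [u] is nonzero, as seen at [h 1], and [u e = 0] while [s e = 1] on [S], so [S] misses the
   line through [u]. *)
have [||A [s [Ac Ss sU]]] := exists_isolated_point (u := d 0 - d 1)
  Sclosed Sball Ytest Yunc _ Sconv Sne.
- move=> u0; have : (d 0 - d 1) (h 1) = 0 by rewrite u0.
  rewrite -[LHS]/(d 0 (h 1) - d 1 (h 1)) !dh ltnn subr0 => /eqP.
  by rewrite oner_eq0.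
- move=> s q Ss sq; have := Se s Ss.
  rewrite sq -[LHS]/(q * (d 0 e - d 1 e)) !de subrr mulr0 => /eqP.
  by rewrite eq_sym oner_eq0.
have [g gT gs] := weak_star_cvg_isolated Tdec
  (fun m mu x (Tmu : T m mu) => let: And4 b _ _ _ := Tmu in b x) Ac Ss sU.
have Phis0 : Phi s = 0.
  apply: (cvg_unique _ (PhiP _)) => //; apply: cvg_near_cst.
  apply: filterE => n.
  by rewrite (evP n).1 Sh.
have := (gX g s).1 gs Phi; rewrite Phis0.
rewrite (_ : (fun n => Phi (g n)) = fun=> 1); last first.
  by apply/funext => n; case: (gT n).
move=> /(cvg_unique (@Rhausdorff R) (cvg_cst _)) /eqP.
by rewrite oner_eq0.
Qed.

(** * Functionals on a space with an overcomplete set *)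

(** By minimality of [omega_1], an uncountable subset of [Y] is as large as [Y], hence linearly
    dense; a continuous functional vanishing on it is zero. *)
Lemma overcomplete_test (R : realType) (X : normedModType R) (Y : set X) :
  dens_omega1 X -> overcomplete Y -> ~ countable Y /\
  forall f : dual X, ~ countable (Y `&` [set y | f y = 0]) -> f = 0.
Proof.
move=> [D [Dunc Dmin] [[D1 D1d D1D] Dle]] [[[D2 D2d D2Y] Yle] Yoc].
have YD : (Y #<= D)%card.
  apply: card_le_trans (Yle _ D1d) _.
  by move: D1D; rewrite card_eq_le => /andP[].
have DY : (D #<= Y)%card.
  apply: card_le_trans (Dle _ D2d) _.
  by move: D2Y; rewrite card_eq_le => /andP[].
split=> [Yc|f Zunc]; first by apply: Dunc; exact: sub_countable DY Yc.
set Z := Y `&` _ in Zunc.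
have ZY : Z `<=` Y by exact: subIsetl.
have Zd : linearly_dense Z.
  apply: Yoc => //; rewrite card_eq_le subset_card_le//=.
  exact: card_le_trans YD (Dmin _ _ Zunc).
apply: dual_ext => x; apply: contrapT => fx.
(* Were [f] nonzero, the dense span of [Z] would meet the open set where [f] does not vanish. *)
have [|| y [fy [n [c [v [vZ yE]]]]]] := Zd (f @^-1` (~` [set 0])).
- by exists x.
- apply: open_comp; last by apply: closed_openC; exact: closed_eq.
  by move=> y _; exact: dual_continuous.
apply: fy; rewrite yE /= linear_sum big1// => i _.
by rewrite linearZ/=; have [_ ->] := vZ i; rewrite scaler0.
Qed.

(** * Interpolating functions and point masses on [K] *)

(** Separate two points of an infinite closed set by disjoint open [U] and [V]. Removing one of them
    leaves an infinite closed set that has lost a point; iterate, with [x n] the point lost. *)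
Lemma infinite_hausdorff_sequence (K : topologicalType) :
  hausdorff_space K -> infinite_set [set: K] ->
  exists (x : nat -> K) (F : nat -> set K),
    [/\ forall n, closed (F n), forall m n, (m <= n)%N -> F n `<=` F m,
        forall n, F n (x n) & forall n, ~ F n.+1 (x n)].
Proof.
move=> hK iK.
pose P (F : set K) := closed F /\ infinite_set F.
have step (F : {F | P F}) : {G : {G | P G} |
    sval G `<=` sval F /\ exists x, sval F x /\ ~ sval G x}.
  apply: cid; case: F => F [Fcl Finf] /=.
  have [a Fa] := infinite_setN0 Finf.
  have [b Fb] : (F `\ a) !=set0 by apply: infinite_setN0; apply: infinite_setD.
  have ab : a != b by case: Fb => _ /= /eqP; rewrite eq_sym.
  have := hK; rewrite open_hausdorff => /(_ _ _ ab)[[U V]] /=.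
  rewrite !inE => -[Ua Vb] [oU oV UV].
  have FE : F = (F `\` U) `|` (F `\` V).
    by rewrite -setDIr UV setD0.
  have [FU|FV] : infinite_set (F `\` U) \/ infinite_set (F `\` V).
    apply: contrapT => /not_orP[/contrapT fU /contrapT fV].
    by apply: Finf; rewrite FE finite_setU.
  - have PG : P (F `\` U).
      by split=> //; apply: closedI => //; exact: open_closedC.
    exists (exist _ _ PG); split; first exact: subDsetl.
    by exists a; split=> // -[_].
  - have PG : P (F `\` V).
      by split=> //; apply: closedI => //; exact: open_closedC.
    exists (exist _ _ PG); split; [exact: subDsetl|exists b; split=> [|[_]//]].
    by case: Fb.
have [f [_ fS]] := dependent_choice step (exist P _ (conj closedT iK)).
have /choice[x xP] := fun n => (fS n).2.
exists x, (fun n => sval (f n)); split.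
- by move=> n; case: (f n) => F [].
- move=> m n /subnK <-; elim: (n - m)%N => [//|k IH].
  by rewrite addSn; apply: subset_trans IH; exact: (fS _).1.
- by move=> n; exact: (xP n).1.
- by move=> n; exact: (xP n).2.
Qed.

(** Urysohn's lemma: [F n] contains all [x m] with [m >= n] and none of the finitely many earlier
    ones, so some [h n] is 0 on [F n] and 1 on the latter. *)
Lemma interpolating_functions (R : realType) (K : topologicalType)
    (cK : compact [set: K]) :
  hausdorff_space K -> infinite_set [set: K] ->
  exists (x : nat -> K) (h : nat -> Cspace R cK),
    (forall n, `|h n| <= 1) /\ forall m n, h n (x m) = (m < n)%:R.
Proof.
move=> hK iK.
have [x [F [Fcl Fdec Fx nFx]]] := infinite_hausdorff_sequence hK iK.
suff /choice[h hP] : forall n, exists h : Cspace R cK,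
    `|h| <= 1 /\ forall m, h (x m) = (m < n)%:R.
  by exists x, h; split=> [n|m n]; [exact: (hP n).1|exact: (hP n).2].
move=> n.
have Bcl : closed (x @` `I_n).
  apply: (accessible_finite_set_closed.1 (hausdorff_accessible hK)).
  exact: finite_image.
have FB : F n `&` (x @` `I_n) = set0.
  apply/seteqP; split=> // y [Fy [i /= im xy]].
  by apply: (nFx i); rewrite xy; exact: Fdec im _ Fy.
have /(uniform_separatorP (R := R))[f [fc f01 f0 f1]] :=
  normal_uniform_separator (compact_normal hK cK) (Fcl n) Bcl FB.
exists (C_mk cK fc); split.
  apply: C_norm_le => // y; have /f01 : range f (f y) by exists y.
  by rewrite /= in_itv /= => /andP[f0y fy1]; rewrite ger0_norm.
move=> m; case: ltnP => mn /=.
  by apply: f1; exists (x m) => //; exists m.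
by apply: f0; exists (x m) => //; exact: Fdec mn _ (Fx m).
Qed.

Lemma point_evaluation (R : realType) (K : topologicalType)
    (cK : compact [set: K]) (x : K) :
  exists d : dual (Cspace R cK), forall f, d f = f x.
Proof.
pose g (f : Cspace R cK) : R := f x.
have glin : linear g by [].
have gle f : `|g f| <= `|f| by exact: C_norm_ub.
by exists (Dual glin (contraction_continuous glin gle)).
Qed.

Local Close Scope ring_scope.
Unset Implicit Arguments.

Theorem theorem36 (R : realType) (K : topologicalType)
    (cK : compact [set: K]) (hK : hausdorff_space K)
    (iK : infinite_set [set: K])
    (gK : grothendieck (Cspace R cK)) (dK : dens_omega1 (Cspace R cK)) :
  ~ exists Y : set (Cspace R cK), overcomplete Y.
Proof.
move=> [Y /(overcomplete_test dK)[Yunc Ytest]].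
have [x [h [h1 hx]]] := @interpolating_functions R K cK hK iK.
have /choice[d dP] := fun m => @point_evaluation R K cK (x m).
have onec : continuous (fun _ : K => 1%R : R) by move=> y; exact: cvg_cst.
pose e : Cspace R cK := C_mk cK onec.
apply: (not_grothendieck (d := d) (e := e) Yunc Ytest h1 _ _ _ gK) => [|m n|m].
- by move=> m f; rewrite dP; exact: C_norm_ub.
- by rewrite dP.
- by rewrite (dP m e).
Qed.
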